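(* Let $Y$ be a real topological vector space, $F\subseteq Y$, $a\in Y$, let $H$ be a proper closed subset of $Y$ and $k\in 0^+H\setminus\{0\}$ with $k\in\operatorname{int}0^+H$. Then: (a) $F$ is the feasible range of each problem $(P_{F,b,H,k^0})$ with $b\in Y$, $k^0\in\operatorname{int}0^+H$. (b) If the objective function of $(P_{F,a,H,k})$ is not bounded below on $F$, then none of the problems $(P_{F,b,H,k^0})$ with $b\in Y$ and $k^0\in\operatorname{int}0^+H$ has an optimal solution.
   Context: For $A\subseteq Y$, the recession cone is $0^+A:=\{u\in Y\mid A+\mathbb{R}_+u\subseteq A\}$, where $\mathbb{R}_+=[0,\infty)$. A proper subset of $Y$ is a nonempty subset different from $Y$. $\operatorname{int}$ denotes the topological interior. For $b\in Y$ and $k^0\in 0^+H\setminus\{0\}$, $(P_{F,b,H,k^0})$ is the problem of minimizing $t$ over all pairs $(y,t)\in F\times\mathbb{R}$ with $y\in b-H+tk^0$ (the feasible solutions). Its feasible range is the set of all $y\in F$ such that $(y,t)$ is feasible for some $t\in\mathbb{R}$. An optimal solution is a feasible $(y,t)$ with $t\le s$ for every feasible $(z,s)$. The objective function of $(P_{F,a,H,k})$ being not bounded below on $F$ means that the values $t$ over all feasible pairs $(y,t)$ are not bounded below; equivalently, $\varphi_{a-H,k}(y):=\inf\{t\in\mathbb{R}\mid y\in a-H+tk\}$ is not bounded below on $F$. *)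

(* Defs.v *)
From mathcomp Require Import all_boot all_order all_algebra.
From mathcomp Require Import all_classical all_reals all_analysis.

Set Implicit Arguments.
Unset Strict Implicit.
Unset Printing Implicit Defensive.

Import Order.TTheory GRing.Theory Num.Theory.
Import numFieldNormedType.Exports.

Local Open Scope classical_set_scope.
Local Open Scope ring_scope.

(* [topologicalLmodType R] is used rather than the library's [tvsType R]: the
   latter additionally requires local convexity. Neither requires the
   Hausdorff property. *)

Definition proper_subset (T : Type) (A : set T) : Prop :=
  A !=set0 /\ A <> [set: T].

Definition recession_cone (R : realType) (Y : topologicalLmodType R)
    (A : set Y) : set Y :=
  [set u | [set x + t *: u | x in A & t in [set t : R | 0 <= t]] `<=` A].

(* Minimize [t] over the pairs [(y, t)] with [y \in F] and
   [y \in b - H + t k0], for [k0] a nonzero element of [recession_cone H]. *)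
Definition feasible (R : realType) (Y : topologicalLmodType R)
    (F : set Y) (b : Y) (H : set Y) (k0 : Y) : set (Y * R) :=
  [set yt | F yt.1 /\ [set b - h + yt.2 *: k0 | h in H] yt.1].

Definition feasible_range (R : realType) (Y : topologicalLmodType R)
    (F : set Y) (b : Y) (H : set Y) (k0 : Y) : set Y :=
  [set y | F y /\ exists t : R, feasible F b H k0 (y, t)].

Definition optimal_solution (R : realType) (Y : topologicalLmodType R)
    (F : set Y) (b : Y) (H : set Y) (k0 : Y) (yt : Y * R) : Prop :=
  feasible F b H k0 yt /\
  forall zs : Y * R, feasible F b H k0 zs -> yt.2 <= zs.2.

Definition objective_bounded_below (R : realType) (Y : topologicalLmodType R)
    (F : set Y) (b : Y) (H : set Y) (k0 : Y) : Prop :=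
  has_lbound [set yt.2 | yt in feasible F b H k0].

(* Main.v *)
Require Import Defs.
From mathcomp Require Import all_boot all_order all_algebra.
From mathcomp Require Import all_classical all_reals all_analysis.

Import Order.TTheory GRing.Theory Num.Theory.
Import numFieldNormedType.Exports.

Local Open Scope classical_set_scope.
Local Open Scope ring_scope.

(** An interior point [k] of the recession cone is an order unit for it: every [v]
is absorbed, i.e. [v + s k] lies in the cone for all large [s]. Hence any point
of [F] becomes feasible for [t] large. If [(z, s)] is feasible for [(a, k)] with
[s] very negative, then [(z, t)] is feasible for [(b, k0)] for any prescribed
[t], since [b - z + t k0 = (a - z + s k) + ((b - a + t k0) + (- s) k)]. *)

Lemma recession_coneZ (R : realType) (Y : topologicalLmodType R) (A : set Y)
    (c : R) (u : Y) :
  0 <= c -> recession_cone A u -> recession_cone A (c *: u).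
Proof.
move=> c0 Au _ [x Ax [t /= t0 <-]]; rewrite scalerA.
by apply: Au; exists x => //; exists (t * c) => //=; exact: mulr_ge0.
Qed.

Lemma recession_cone_add (R : realType) (Y : topologicalLmodType R) (A : set Y)
    (x u : Y) :
  A x -> recession_cone A u -> A (x + u).
Proof.
move=> Ax Au; apply: Au; exists x => //; exists 1 => /=; first exact: ler01.
by rewrite scale1r.
Qed.

(** Since [k + e *: v] tends to [k] as [e] tends to [0], the point [k + s^-1 *: v] lies in the cone
    for all large [s]; scaling it by [s] gives [v + s *: k]. *)
Lemma interior_recession_cone_absorbs {R : realType}
    {Y : topologicalLmodType R} {A : set Y} {k : Y} (v : Y) :
  interior (recession_cone A) k ->
  exists2 T : R, 0 < T & forall s, T <= s -> recession_cone A (v + s *: k).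
Proof.
move=> Ak.
have cvk : (fun e : R => k + e *: v) @ (0 : R) --> k.
  (* The limit is written as [k + 0 *: v] so that joint continuity of addition and of scaling
     applies at that point. *)
  rewrite -[X in _ --> X]addr0 -[X in _ --> _ + X](scale0r v).
  apply: (continuous2_cvg _ (h := fun x y : Y => x + y) (f := cst k)
    (g := fun e : R => e *: v) (add_continuous (k, 0 *: v)));
    first exact: cvg_cst.
  apply: (continuous2_cvg _ (h := fun (x : R^o) (y : Y) => x *: y)
    (f := fun e : R => e) (g := cst v) (scale_continuous (0, v)));
    [exact: cvg_id|exact: cvg_cst].
have /nbhs_ballP[e /= e0 eA] := cvk _ Ak.
(* The factor [2] makes [s^-1 < e] strict, as the open ball requires. *)
exists (2 / e) => [|s es]; first by rewrite divr_gt0.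
have s0 : 0 < s by apply: lt_le_trans es; rewrite divr_gt0.
have -> : v + s *: k = s *: (k + s^-1 *: v).
  by rewrite scalerDr scalerA divff ?gt_eqF// scale1r addrC.
apply: recession_coneZ; first exact: ltW.
apply: eA; rewrite /ball /= sub0r normrN gtr0_norm ?invr_gt0//.
rewrite invf_plt ?posrE//; apply: lt_le_trans es.
by rewrite ltr_pdivlMr// mulVf ?gt_eqF// ltr1n.
Qed.

(** Solving [y = b - h + t *: k0] for [h] leaves a membership in [H], to which recession directions
    can be added. *)
Lemma feasibleP (R : realType) (Y : topologicalLmodType R)
    (F : set Y) (b : Y) (H : set Y) (k0 y : Y) (t : R) :
  feasible F b H k0 (y, t) <-> F y /\ H (b - y + t *: k0).
Proof.
split=> -[/= Fy].
- case=> h Hh hy; split=> //.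
  by rewrite -hy opprD addrA subrK subKr.
- move=> Hy; split=> //; exists (b - y + t *: k0) => //.
  by rewrite opprD addrA subrK subKr.
Qed.

Theorem proposition16 (R : realType) (Y : topologicalLmodType R)
    (F : set Y) (a : Y) (H : set Y) (k : Y)
    (H_proper : proper_subset H) (H_closed : closed H)
    (k_rec : (recession_cone H `\ (0 : Y)) k)
    (k_int : interior (recession_cone H) k) :
  (forall b k0 : Y, interior (recession_cone H) k0 ->
     feasible_range F b H k0 = F) /\
  (~ objective_bounded_below F a H k ->
   forall b k0 : Y, interior (recession_cone H) k0 ->
     ~ exists yt : Y * R, optimal_solution F b H k0 yt).
Proof.
have [[h0 Hh0] _] := H_proper.
split=> [b k0 k0_int|unbounded b k0 _ [[y t] [_ t_min]]].
  apply/seteqP; split=> [y []//|y Fy]; split=> //.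
  (* The absorbed vector is the gap from the fixed point [h0] of [H] to [b - y]. *)
  have [T _ /(_ _ (lexx T)) HT] :=
    interior_recession_cone_absorbs (b - y - h0) k0_int.
  exists T; apply/feasibleP; split=> //.
  have -> : b - y + T *: k0 = h0 + (b - y - h0 + T *: k0).
    by rewrite addrA [h0 + _]addrC subrK.
  exact: recession_cone_add.
(* The value [t - 1] stands for any value below the optimum. The threshold [T] does not depend on
   [z] or [s], so [- T] can serve as a lower bound. *)
have [T _ HT] :=
  interior_recession_cone_absorbs (b - a + (t - 1) *: k0) k_int.
apply: unbounded; exists (- T) => _ [[z s] /feasibleP[Fz Hz] <-] /=.
rewrite leNgt; apply/negP => sT.
suff /t_min /= : feasible F b H k0 (z, t - 1).
  by rewrite leNgt ltrBlDr ltrDl ltr01.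
apply/feasibleP; split=> //.
have /HT Hu : T <= - s by rewrite lerNr ltW.
have -> : b - z + (t - 1) *: k0 =
    a - z + s *: k + (b - a + (t - 1) *: k0 + - s *: k).
  rewrite scaleNr addrACA subrr addr0 addrA [a - z + _]addrC.
  by rewrite subrKA.
exact: recession_cone_add.
Qed.
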